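(* Let $n\ge2$. The augmented matrix $\mathbf{W}$ of an oriented Descartes configuration of $n+2$ spheres $\{S_i: 1\le i\le n+2\}$ in $\mathbb{R}^n$ satisfies $$\mathbf{W}^T\mathbf{Q}_n\mathbf{W} = \begin{bmatrix} 0&-4&0\\-4&0&0\\0&0&2I_n\end{bmatrix}.$$ Conversely, any real $(n+2)\times(n+2)$ matrix $\mathbf{W}$ satisfying this equation is the augmented matrix of a unique oriented Descartes configuration.
   Context: $\mathbf{Q}_n := I_{n+2} - \frac1n \mathbf{1}_{n+2}\mathbf{1}_{n+2}^T$, where $\mathbf{1}_{n+2}$ is the column vector of $n+2$ ones. An oriented sphere in $\mathbb{R}^n$ is an $(n-1)$-sphere with an assigned direction of unit normal vector, inward or outward. If it has radius $\rho>0$, its oriented radius is $r=\rho$ for an inward normal and $r=-\rho$ for an outward normal, and its oriented curvature is $b=1/r$. Its interior is the usual interior for an inward normal and the usual exterior for an outward normal. Hyperplanes are allowed as oriented spheres of curvature $0$: an oriented hyperplane has a specified unit normal vector $\mathbf{h}$, and its interior is the open half-space into which $\mathbf{h}$ points. Two parallel hyperplanes are regarded as tangent at infinity. An oriented Descartes configuration in $\mathbb{R}^n$ consists of $n+2$ mutually tangent oriented spheres (hyperplanes allowed), all pairs having distinct points of tangency, such that either the interiors of all of them are disjoint, or they are disjoint after all orientations are reversed. Inversion in the unit sphere sends $\mathbf{x}$ to $\mathbf{x}/|\mathbf{x}|^2$. It takes an oriented sphere $S$ with center $\mathbf{x}$ and oriented radius $r$ to the oriented sphere $\bar S$ with center $\mathbf{x}/(|\mathbf{x}|^2-r^2)$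 and oriented radius $r/(|\mathbf{x}|^2-r^2)$ (a hyperplane if $|\mathbf{x}|^2=r^2$). Thus the oriented curvature of $\bar S$ is $\bar b = \frac{|\mathbf{x}|^2}{r}-r$. For an oriented hyperplane $H=\{\mathbf{x}:\mathbf{h}\cdot\mathbf{x}=c\}$ with unit normal $\mathbf{h}$, the oriented curvature of its inverse $\bar H$ is $\bar b=2c$. The augmented curvature-center coordinates of an oriented sphere $S$ with oriented curvature $b\neq0$ and center $(x_1,\ldots,x_n)$ are $\mathbf{w}(S)=(\bar b,b,bx_1,\ldots,bx_n)$, where $\bar b$ is the oriented curvature of $\bar S$; for an oriented hyperplane $H$ with unit normal $(h_1,\ldots,h_n)$ they are $\mathbf{w}(H)=(\bar b,0,h_1,\ldots,h_n)$, where $\bar b$ is the oriented curvature of $\bar H$. The augmented matrix $\mathbf{W}$ of a collection $(S_1,\ldots,S_{n+2})$ is the $(n+2)\times(n+2)$ matrix whose $j$-th row is $\mathbf{w}(S_j)$. *)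

(* Defs.v *)
From HB Require Import structures.
From mathcomp Require Import all_boot all_order all_algebra.
From mathcomp Require Import boolp classical_sets reals.
From mathcomp Require Import ring lra.

Set Implicit Arguments.
Unset Strict Implicit.
Unset Printing Implicit Defensive.

Import Order.TTheory GRing.Theory Num.Theory.

Local Open Scope classical_set_scope.
Local Open Scope ring_scope.

Definition dotv (R : realType) (n : nat) (u v : 'rV[R]_n) : R :=
  (u *m v^T) 0 0.

Definition sqnorm (R : realType) (n : nat) (u : 'rV[R]_n) : R := dotv u u.

Section DotProduct.
Variables (R : realType) (n : nat).
Implicit Types u v w : 'rV[R]_n.

Lemma dotvE u v : dotv u v = \sum_i u 0 i * v 0 i.
Proof. by rewrite /dotv mxE; apply: eq_bigr => i _; rewrite mxE. Qed.

Lemma dotvC u v : dotv u v = dotv v u.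
Proof. by rewrite !dotvE; apply: eq_bigr => i _; rewrite mulrC. Qed.

Lemma dotvDl u v w : dotv (u + v) w = dotv u w + dotv v w.
Proof. by rewrite /dotv mulmxDl mxE. Qed.

Lemma dotvDr u v w : dotv u (v + w) = dotv u v + dotv u w.
Proof. by rewrite dotvC dotvDl !(dotvC u). Qed.

Lemma dotvZl a u v : dotv (a *: u) v = a * dotv u v.
Proof. by rewrite /dotv -scalemxAl mxE. Qed.

Lemma dotvZr a u v : dotv u (a *: v) = a * dotv u v.
Proof. by rewrite dotvC dotvZl dotvC. Qed.

Lemma dotvNl u v : dotv (- u) v = - dotv u v.
Proof. by rewrite -scaleN1r dotvZl mulN1r. Qed.

Lemma sqnormN u : sqnorm (- u) = sqnorm u.
Proof. by rewrite /sqnorm dotvNl dotvC dotvNl opprK. Qed.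

Lemma sqnormZ a u : sqnorm (a *: u) = a ^+ 2 * sqnorm u.
Proof. by rewrite /sqnorm dotvZl dotvZr mulrA. Qed.

Lemma sqnormB u v : sqnorm (u - v) = sqnorm u - 2 * dotv u v + sqnorm v.
Proof.
rewrite /sqnorm !dotvDl !dotvDr ![dotv _ (- v)]dotvC !dotvNl (dotvC _ (- v)).
by rewrite dotvNl (dotvC v u); ring.
Qed.

Lemma sqnorm_gt0 u : u != 0 -> 0 < sqnorm u.
Proof.
move=> u0; rewrite /sqnorm dotvE lt_def; apply/andP; split; last first.
  by apply: sumr_ge0 => i _; rewrite -expr2 sqr_ge0.
apply: contraNneq u0 => s0; apply/eqP/rowP => i; rewrite mxE; apply/eqP.
have := @psumr_eq0P _ _ predT (fun i => u 0 i * u 0 i).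
move=> /(_ (fun i _ => sqr_ge0 (u 0 i)) s0 i isT) /eqP.
by rewrite mulf_eq0 orbb.
Qed.

End DotProduct.

(* [OSphere x r _] has center x and signed radius r, positive when the chosen
   unit normal points inward; [OPlane h c _] is {y | h . y = c} with chosen
   unit normal h.  For n >= 2 distinct terms are distinct oriented spheres:
   the opposite orientations are (x, - r) and (- h, - c). *)
Inductive osphere (R : realType) (n : nat) : Type :=
  | OSphere (x : 'rV[R]_n) (r : R) of r != 0
  | OPlane (h : 'rV[R]_n) (c : R) of sqnorm h == 1.

Section OrientedSpheres.
Variables (R : realType) (n : nat).
Implicit Types S T : osphere R n.

(* Points of the one-point compactification of R^n, [None] being infinity. *)
Definition ocarrier S : set (option 'rV[R]_n) :=
  match S with
  | OSphere x r _ => [set p | exists2 y, p = Some y & sqnorm (y - x) = r ^+ 2]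
  | OPlane h c _ =>
      [set p | p = None \/ exists2 y, p = Some y & dotv h y = c]
  end.

Definition ointerior S : set 'rV[R]_n :=
  match S with
  | OSphere x r _ =>
      if 0 < r then [set y | sqnorm (y - x) < r ^+ 2]
      else [set y | r ^+ 2 < sqnorm (y - x)]
  | OPlane h c _ => [set y | c < dotv h y]
  end.

Definition ocurv S : R := if S is OSphere _ r _ then r^-1 else 0.

Fact oreverse_sphere_subproof (r : R) : r != 0 -> - r != 0.
Proof. by rewrite oppr_eq0. Qed.

Fact oreverse_plane_subproof (h : 'rV[R]_n) :
  sqnorm h == 1 -> sqnorm (- h) == 1.
Proof. by rewrite sqnormN. Qed.

Definition oreverse S : osphere R n :=
  match S with
  | OSphere x _ r0 => OSphere x (oreverse_sphere_subproof r0)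
  | OPlane _ c h1 => OPlane (- c) (oreverse_plane_subproof h1)
  end.

Fact oinv_sphere_plane_subproof (x : 'rV[R]_n) (r : R) :
  r != 0 -> sqnorm x = r ^+ 2 -> sqnorm (r^-1 *: x) == 1.
Proof.
by move=> r0 e; rewrite sqnormZ e exprVn mulVf // expf_eq0.
Qed.

Fact oinv_sphere_sphere_subproof (x : 'rV[R]_n) (r : R) :
  r != 0 -> sqnorm x <> r ^+ 2 -> r / (sqnorm x - r ^+ 2) != 0.
Proof. by move=> r0 /eqP ne; rewrite mulf_neq0 // invr_eq0 subr_eq0. Qed.

Fact oinv_plane_sphere_subproof (c : R) : c <> 0 -> (2 * c)^-1 != 0.
Proof. by move=> /eqP c0; rewrite invr_eq0 mulf_neq0 // pnatr_eq0. Qed.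

(* The image of an oriented sphere under inversion in the unit sphere;
   [ocarrier_oinv] and [ointerior_oinv] below check it against y |-> y / |y|^2. *)
Definition oinv S : osphere R n :=
  match S with
  | OSphere x r r0 =>
      match @eqP _ (sqnorm x) (r ^+ 2) with
      | ReflectT e => OPlane (2 * r)^-1 (oinv_sphere_plane_subproof r0 e)
      | ReflectF ne =>
          OSphere ((sqnorm x - r ^+ 2)^-1 *: x)
                  (oinv_sphere_sphere_subproof r0 ne)
      end
  | OPlane h c h1 =>
      match @eqP _ c 0 with
      | ReflectT _ => OPlane 0 h1
      | ReflectF c0 =>
          OSphere ((2 * c)^-1 *: h) (oinv_plane_sphere_subproof c0)
      end
  end.

Lemma ocurv_oinv_sphere (x : 'rV[R]_n) r (r0 : r != 0) :
  ocurv (oinv (OSphere x r0)) = sqnorm x / r - r.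
Proof.
rewrite /oinv; case: eqP => [e | ne] /=.
  by rewrite e expr2 mulfK // subrr.
by rewrite invfM invrK mulrBr expr2 mulKf // mulrC.
Qed.

Lemma ocurv_oinv_plane (h : 'rV[R]_n) c (h1 : sqnorm h == 1) :
  ocurv (oinv (OPlane c h1)) = 2 * c.
Proof.
by rewrite /oinv; case: eqP => [-> | c0] /=; rewrite ?mulr0 ?invrK.
Qed.

Definition inversion (p : option 'rV[R]_n) : option 'rV[R]_n :=
  match p with
  | None => Some 0
  | Some y => if y == 0 then None else Some ((sqnorm y)^-1 *: y)
  end.

Lemma sqnorm_inversion (x y : 'rV[R]_n) (r : R) : y != 0 ->
  sqnorm ((sqnorm y)^-1 *: y - x) - r ^+ 2 =
  (1 - 2 * dotv y x + (sqnorm x - r ^+ 2) * sqnorm y) / sqnorm y.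
Proof.
move=> /sqnorm_gt0 /lt0r_neq0 y0.
by rewrite sqnormB sqnormZ dotvZl; field.
Qed.

Lemma sqnorm_oinv_center (x y : 'rV[R]_n) (r : R) : sqnorm x <> r ^+ 2 ->
  sqnorm (y - (sqnorm x - r ^+ 2)^-1 *: x) - (r / (sqnorm x - r ^+ 2)) ^+ 2 =
  (1 - 2 * dotv y x + (sqnorm x - r ^+ 2) * sqnorm y) / (sqnorm x - r ^+ 2).
Proof.
move=> /eqP; rewrite -subr_eq0 => D0.
rewrite sqnormB sqnormZ dotvZr; field.
exact: D0.
Qed.

Lemma sqnorm_oinv_plane (h y : 'rV[R]_n) (c : R) : sqnorm h = 1 -> c <> 0 ->
  sqnorm (y - (2 * c)^-1 *: h) - (2 * c)^-1 ^+ 2 =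
  (c * sqnorm y - dotv h y) / c.
Proof.
move=> h1 /eqP c0; rewrite sqnormB sqnormZ dotvZr h1 (dotvC h); field.
exact: c0.
Qed.

(* Tangency as meeting in exactly one point of the compactification: parallel
   distinct hyperplanes meet only at infinity, while crossing hyperplanes
   (even two lines in the plane) also share a finite point. *)
Definition tangent_at S T (p : option 'rV[R]_n) : Prop :=
  ocarrier S `&` ocarrier T = [set p].

Definition descartes (S : {ffun 'I_(2 + n) -> osphere R n}) : Prop :=
  [/\ forall i j, i != j -> exists p, tangent_at (S i) (S j) p,
      forall i j k l p, i != j -> k != l ->
        tangent_at (S i) (S j) p -> tangent_at (S k) (S l) p ->
        (i = k /\ j = l) \/ (i = l /\ j = k)
    & trivIset setT (fun i => ointerior (S i)) \/
      trivIset setT (fun i => ointerior (oreverse (S i)))].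

Definition aug_coords S : 'rV[R]_(2 + n) :=
  row_mx (\row_(k < 2) (if k == 0 then ocurv (oinv S) else ocurv S))
         (match S with
          | OSphere x _ _ => ocurv S *: x
          | OPlane h _ _ => h
          end).

Definition aug_mx (S : {ffun 'I_(2 + n) -> osphere R n}) : 'M[R]_(2 + n) :=
  \matrix_(j < 2 + n) aug_coords (S j).

Definition descartes_form : 'M[R]_(2 + n) :=
  1%:M - n%:R^-1 *: (const_mx 1 *m (const_mx 1 : 'cV[R]_(2 + n))^T).

Definition aug_form : 'M[R]_(2 + n) :=
  block_mx (\matrix_(i < 2, j < 2) (if i == j then 0 else - 4)) 0
           0 (2%:M).

Lemma ocarrier_oinv S p : ocarrier (oinv S) p <-> ocarrier S (inversion p).
Proof.
have dot0 (h : 'rV[R]_n) : dotv h 0 = 0 by rewrite -(scale0r h) dotvZr mul0r.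
have exS (P : 'rV[R]_n -> Prop) y : (exists2 z, Some y = Some z & P z) = P y.
  by apply/propext; split=> [[_ [<-]] // | Py]; exists y.
have exN (P : 'rV[R]_n -> Prop) : (exists2 z, None = Some z & P z) = False.
  by apply/propext; split=> [[] |].
have SN (y : 'rV[R]_n) : (Some y = None) = False by apply/propext.
have NN : (@None 'rV[R]_n = None) = True by apply/propext.
have orF P : (False \/ P) = P by apply/propext; split=> [[] | ] //; right.
have orT P : (True \/ P) = True by apply/propext; split=> // _; left.
have subE (a b : R) : (a = b) = (a - b = 0).
  by apply/propext; split=> [-> | /subr0_eq //]; rewrite subrr.
case: S => [x r r0 | h c h1]; rewrite /oinv; case: eqP => [e | ne];
  case: p => [y|] /=; do ?[case: eqVneq => [-> | y0]] => /=;
  rewrite ?(exS, exN, SN, NN, dot0, sub0r, sqnormN, sqnormZ, dotvZr, orF, orT).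
- split=> // /esym /eqP.
  by rewrite invr_eq0 mulf_eq0 pnatr_eq0 (negPf r0).
- rewrite (subE (sqnorm _)) (sqnorm_inversion _ _ y0) e subrr mul0r addr0.
  have s0 := lt0r_neq0 (sqnorm_gt0 y0).
  rewrite dotvZl (dotvC x) invfM mulrC; split=> [|/eqP].
    move=> /(mulIf (invr_neq0 r0)) ->.
    by rewrite mulfV ?pnatr_eq0 // subrr mul0r.
  rewrite mulf_eq0 invr_eq0 (negPf s0) orbF subr_eq0 => /eqP dE; congr (_ / r).
  lra.
- by [].
- split=> // /eqP; rewrite exprMn mulrC exprVn.
  have D0 : (sqnorm x - r ^+ 2) ^+ 2 != 0 by rewrite expf_eq0 subr_eq0; apply/eqP.
  by move=> /eqP /(mulIf (invr_neq0 D0)).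
- rewrite subE (sqnorm_oinv_center _ ne) [X in _ <-> X]subE sqnorm_inversion //.
  have D0 : sqnorm x - r ^+ 2 != 0 by rewrite subr_eq0; apply/eqP.
  have s0 := lt0r_neq0 (sqnorm_gt0 y0).
  by split=> /eqP; rewrite mulf_eq0 invr_eq0 ?(negPf D0) ?(negPf s0) orbF => /eqP ->;
    rewrite mul0r.
- by [].
- by [].
- rewrite e; split=> [-> | /eqP]; first by rewrite mulr0.
  have s0 := lt0r_neq0 (sqnorm_gt0 y0).
  by rewrite mulf_eq0 invr_eq0 (negPf s0) => /eqP.
- by rewrite e.
- by split=> // _; rewrite (eqP h1) mulr1.
- rewrite subE (sqnorm_oinv_plane _ (eqP h1) ne).
  have s0 := lt0r_neq0 (sqnorm_gt0 y0).
  have /eqP c0 := ne.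
  split=> [/eqP | <-]; last by rewrite mulrAC mulVf // mul1r subrr mul0r.
  rewrite mulf_eq0 invr_eq0 (negPf c0) orbF subr_eq0 => /eqP <-.
  by rewrite mulrC mulfK.
- by split=> // /esym.
Qed.

Lemma ointerior_oinv S (y : 'rV[R]_n) : y != 0 ->
  ointerior (oinv S) y <-> ointerior S ((sqnorm y)^-1 *: y).
Proof.
move=> y0; have s0 := sqnorm_gt0 y0; have sn := lt0r_neq0 s0.
case: S => [x r r0 | h c h1]; rewrite /oinv; case: eqP => [e | ne] /=.
- have := sqnorm_inversion x r y0; rewrite e subrr mul0r addr0 => E.
  rewrite dotvZl (dotvC x) invfM; case: ifP => [r_gt0 | /negbT r_le0] /=.
    rewrite -[sqnorm _ < _]subr_lt0 E pmulr_llt0 ?invr_gt0 //.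
    rewrite mulrC ltr_pM2l ?invr_gt0 // subr_lt0.
    by split=> H; lra.
  have r_lt0 : r < 0 by rewrite lt_neqAle r0 leNgt.
  rewrite -[_ < sqnorm _]subr_gt0 E pmulr_lgt0 ?invr_gt0 //.
  rewrite mulrC ltr_nM2l ?invr_lt0 // subr_gt0.
  by split=> H; lra.
- have := sqnorm_inversion x r y0; have := sqnorm_oinv_center y ne.
  set E := 1 - _ + _ => E1 E2.
  have D0 : sqnorm x - r ^+ 2 != 0 by rewrite subr_eq0; apply/eqP.
  case: (ltgtP (sqnorm x - r ^+ 2) 0) D0 => // D0 _;
    case: (ltgtP r 0) r0 => // r0 _.
  + rewrite nmulr_rgt0 // invr_lt0 D0 /=.
    rewrite -[sqnorm (y - _) < _]subr_lt0 E1 -[_ < sqnorm (_ - x)]subr_gt0 E2.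
    by rewrite nmulr_llt0 ?invr_lt0 // pmulr_lgt0 ?invr_gt0.
  + rewrite pmulr_rgt0 // invr_gt0 ltNge (ltW D0) /=.
    rewrite -[_ < sqnorm (y - _)]subr_gt0 E1 -[sqnorm (_ - x) < _]subr_lt0 E2.
    by rewrite nmulr_lgt0 ?invr_lt0 // pmulr_llt0 ?invr_gt0.
  + rewrite nmulr_rgt0 // invr_lt0 ltNge (ltW D0) /=.
    rewrite -[_ < sqnorm (y - _)]subr_gt0 E1 -[_ < sqnorm (_ - x)]subr_gt0 E2.
    by rewrite !pmulr_lgt0 ?invr_gt0.
  + rewrite pmulr_rgt0 // invr_gt0 D0 /=.
    rewrite -[sqnorm (y - _) < _]subr_lt0 E1 -[sqnorm (_ - x) < _]subr_lt0 E2.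
    by rewrite !pmulr_llt0 ?invr_gt0.
- rewrite e dotvZr pmulr_rgt0 ?invr_gt0 //.
- have := sqnorm_oinv_plane y (eqP h1) ne => E1.
  have E2 : (c < dotv h ((sqnorm y)^-1 *: y)) = (c * sqnorm y - dotv h y < 0).
    by rewrite dotvZr mulrC ltr_pdivlMr // subr_lt0.
  rewrite E2 invr_gt0 pmulr_rgt0 //.
  case: (ltgtP c 0) ne => // c0 _ /=.
    by rewrite -[_ < sqnorm _]subr_gt0 E1 nmulr_lgt0 ?invr_lt0.
  by rewrite -[sqnorm _ < _]subr_lt0 E1 pmulr_llt0 ?invr_gt0.
Qed.

End OrientedSpheres.

(* Main.v *)
(** Augmented coordinates turn oriented spheres into the unit vectors [w] of
    the Lorentz form [<w, w'> = v . v' - (bbar b' + b bbar') / 2], and points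
    of the compactification into null rays: [y] to [(|y|^2, 1, y)], infinity to
    [(1, 0, 0)].  A point lies on (inside) [S] iff its pairing with [w(S)] is
    zero (positive), and two such null vectors pair nonpositively, to zero only
    if they are equal.  The matrix equation says that the Gram matrix of the
    rows of [W] is [2 I - 1 1^T], that is, that distinct rows pair to [-1].
    Then each [w_i + w_j] is a null vector, whose ray is the unique common point
    of [S_i] and [S_j]; different pairs give null vectors with negative product,
    so the points differ and all the sums lie in the same half of the light
    cone, which decides which of the two families of interiors is disjoint. *)

Require Import Defs.
From mathcomp Require Import all_boot all_order all_algebra.
From mathcomp Require Import boolp classical_sets reals.
From mathcomp Require Import ring lra.

Import Order.TTheory GRing.Theory Num.Theory.
Local Open Scope classical_set_scope.
Local Open Scope ring_scope.

(** * The Lorentz form on coordinate vectors *)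

Section Lorentz.
Context {R : realType} {n : nat}.
Implicit Types (u v w : 'rV[R]_(2 + n)) (x y : 'rV[R]_n) (a b c : R).
Implicit Types (p q : option 'rV[R]_n) (S T : osphere R n).

Lemma sqnorm_eq0 y : (sqnorm y == 0) = (y == 0).
Proof.
apply/idP/idP => [|/eqP ->]; last by rewrite /sqnorm /dotv mul0mx mxE.
by apply: contraTT => /sqnorm_gt0 /lt0r_neq0.
Qed.

Lemma sqnorm_ge0 y : 0 <= sqnorm y.
Proof.
by have [/eqP|/sqnorm_gt0 /ltW //] := eqVneq y 0; rewrite -sqnorm_eq0 => /eqP ->.
Qed.

(** Same shape as [aug_coords], so that the coordinates of a sphere become an instance by conversion
    once the curvature of its inverse is computed. *)
Definition lvec a b y : 'rV[R]_(2 + n) :=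
  row_mx (\row_(k < 2) (if k == 0 then a else b)) y.

Definition lfst w : R := w 0 (lshift n 0).
Definition lsnd w : R := w 0 (lshift n 1).

Definition lor u v : R :=
  dotv (rsubmx u) (rsubmx v) - (lfst u * lsnd v + lsnd u * lfst v) / 2.

Lemma lfst_lvec a b y : lfst (lvec a b y) = a.
Proof. by rewrite /lfst row_mxEl mxE. Qed.

Lemma lsnd_lvec a b y : lsnd (lvec a b y) = b.
Proof. by rewrite /lsnd row_mxEl mxE. Qed.

Lemma lvecK w : lvec (lfst w) (lsnd w) (rsubmx w) = w.
Proof.
rewrite -[RHS]hsubmxK; congr row_mx; apply/rowP => k; rewrite !mxE.
by case: k => [[|[|//]] k2]; rewrite /lfst /lsnd; congr (w _ (lshift _ _)); apply: val_inj.
Qed.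

Lemma lvecP w : exists a b y, w = lvec a b y.
Proof. by exists (lfst w), (lsnd w), (rsubmx w); rewrite lvecK. Qed.

Lemma lvec_inj a b y a' b' y' :
  lvec a b y = lvec a' b' y' -> [/\ a = a', b = b' & y = y'].
Proof.
move=> e; split; first by rewrite -(lfst_lvec a b y) e lfst_lvec.
  by rewrite -(lsnd_lvec a b y) e lsnd_lvec.
by have /eq_row_mx[] := e.
Qed.

Lemma lvecZ c a b y : c *: lvec a b y = lvec (c * a) (c * b) (c *: y).
Proof.
rewrite /lvec scale_row_mx; congr row_mx; apply/rowP => k.
by rewrite !mxE; case: ifP.
Qed.

Lemma lor_lvec a b y a' b' y' :
  lor (lvec a b y) (lvec a' b' y') = dotv y y' - (a * b' + b * a') / 2.
Proof. by rewrite /lor !lfst_lvec !lsnd_lvec !row_mxKr. Qed.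

Lemma lorC u v : lor u v = lor v u.
Proof. by rewrite /lor dotvC; ring. Qed.

Lemma lorDl u v w : lor (u + v) w = lor u w + lor v w.
Proof. by rewrite /lor /lfst /lsnd linearD dotvDl !mxE; field. Qed.

Lemma lorDr u v w : lor u (v + w) = lor u v + lor u w.
Proof. by rewrite lorC lorDl !(lorC u). Qed.

Lemma lorZl c u v : lor (c *: u) v = c * lor u v.
Proof. by rewrite /lor /lfst /lsnd linearZ dotvZl !mxE; field. Qed.

Lemma lorZr c u v : lor u (c *: v) = c * lor u v.
Proof. by rewrite lorC lorZl lorC. Qed.

Lemma lorNl u v : lor (- u) v = - lor u v.
Proof. by rewrite -scaleN1r lorZl mulN1r. Qed.

Lemma lorNr u v : lor u (- v) = - lor u v.
Proof. by rewrite lorC lorNl lorC. Qed.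

Lemma lor0 u : lor u 0 = 0.
Proof. by rewrite -(scale0r 0) lorZr mul0r. Qed.

(** * Points of the compactification as null vectors *)

Definition opoint p : 'rV[R]_(2 + n) :=
  if p is Some y then lvec (sqnorm y) 1 y else lvec 1 0 0.

Lemma dotv0 x : dotv x 0 = 0.
Proof. by rewrite -(scale0r 0) dotvZr mul0r. Qed.

Lemma dot0v x : dotv 0 x = 0.
Proof. by rewrite dotvC dotv0. Qed.

Lemma lor_opoint_Some x y :
  lor (opoint (Some x)) (opoint (Some y)) = - sqnorm (x - y) / 2.
Proof. by rewrite /opoint lor_lvec sqnormB; field. Qed.

Lemma lor_opoint_None p : lor (opoint None) (opoint p) = - (p != None)%:R / 2.
Proof.
by case: p => [y|]; rewrite /opoint lor_lvec dot0v /=; field.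
Qed.

Lemma lor_opoint_le0 p q : lor (opoint p) (opoint q) <= 0.
Proof.
case: p q => [x|] q; last by rewrite lor_opoint_None; case: (_ != _) => /=; lra.
case: q => [y|]; last by rewrite lorC lor_opoint_None /=; lra.
by rewrite lor_opoint_Some; have := sqnorm_ge0 (x - y); lra.
Qed.

Lemma lor_opoint_eq0 p q : (lor (opoint p) (opoint q) == 0) = (p == q).
Proof.
case: p q => [x|] [y|]; rewrite ?lor_opoint_Some.
- rewrite mulf_eq0 oppr_eq0 invr_eq0 pnatr_eq0 orbF sqnorm_eq0 subr_eq0.
  by apply/eqP/eqP => [->|[]].
- by rewrite lorC lor_opoint_None /= mulNr mul1r oppr_eq0 invr_eq0 pnatr_eq0.
- by rewrite lor_opoint_None /= mulNr mul1r oppr_eq0 invr_eq0 pnatr_eq0.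
- by rewrite lor_opoint_None /= oppr0 mul0r !eqxx.
Qed.

Lemma lor_opointpp p : lor (opoint p) (opoint p) = 0.
Proof. by apply/eqP; rewrite lor_opoint_eq0. Qed.

(** Nullity reads |y|^2 = a b. If b is nonzero, dividing by b gives the point y / b; if b = 0, then
    y = 0 and the ray is that of infinity. The scalar may be negative: its sign tells the half of
    the cone. *)
Lemma null_opoint w : lor w w = 0 -> w != 0 ->
  exists p, exists2 a, a != 0 & w = a *: opoint p.
Proof.
have [a [b [y ->]]] := lvecP w; rewrite lor_lvec -/(sqnorm y) => e w0.
have {}e : sqnorm y = a * b by lra.
have [b0|b0] := eqVneq b 0.
  have y0 : y = 0 by apply/eqP; rewrite -sqnorm_eq0 e b0 mulr0.
  exists None, a; last by rewrite lvecZ b0 y0 mulr1 mulr0 scaler0.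
  apply: contraNneq w0 => a0.
  by rewrite a0 b0 y0 -(scale0r (lvec 0 0 0)) lvecZ mulr0 scaler0.
exists (Some (b^-1 *: y)), b => //.
by rewrite lvecZ sqnormZ e scalerA mulfV // scale1r mulr1; congr lvec; field.
Qed.

(** * Oriented spheres as unit vectors *)

Lemma aug_sphere x r (r0 : r != 0) :
  aug_coords (OSphere x r0) = lvec (sqnorm x / r - r) r^-1 (r^-1 *: x).
Proof. by rewrite /aug_coords ocurv_oinv_sphere. Qed.

Lemma aug_plane h c (h1 : sqnorm h == 1) :
  aug_coords (OPlane c h1) = lvec (2 * c) 0 h.
Proof. by rewrite /aug_coords ocurv_oinv_plane. Qed.

Lemma lor_aug S : lor (aug_coords S) (aug_coords S) = 1.
Proof.
case: S => [x r r0|h c h1]; rewrite ?aug_sphere ?aug_plane lor_lvec.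
  by rewrite dotvZl dotvZr -/(sqnorm x); field.
by rewrite -/(sqnorm h) (eqP h1); field.
Qed.

(** The unit condition is |y|^2 = 1 + a b. If b = 0, y is a unit normal and the offset is a / 2;
    otherwise it forces a to be the inverse curvature of the sphere with center y / b and radius 1 /
    b. *)
Lemma aug_coords_onto w : lor w w = 1 -> exists S, aug_coords S = w.
Proof.
have [a [b [y ->]]] := lvecP w; rewrite lor_lvec -/(sqnorm y) => e.
have {}e : sqnorm y = 1 + a * b by lra.
have [b0|b0] := eqVneq b 0.
  have y1 : sqnorm y == 1 by rewrite e b0 mulr0 addr0.
  by exists (OPlane (a / 2) y1); rewrite aug_plane b0; congr lvec; field.
have r0 : b^-1 != 0 by rewrite invr_eq0.
exists (OSphere (b^-1 *: y) r0).
rewrite aug_sphere sqnormZ e invrK scalerA mulfV // scale1r.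
by congr lvec; field.
Qed.

Lemma aug_coords_inj : injective (@aug_coords R n).
Proof.
move=> [x r r0|h c h1] [x' r' r0'|h' c' h1'];
  rewrite ?aug_sphere ?aug_plane => /lvec_inj[].
- move=> _ /invr_inj rr; case: _ / rr in r0' * => /(scalerI (invr_neq0 r0)) ->.
  by rewrite (bool_irrelevance r0 r0').
- by move=> _ /eqP; rewrite invr_eq0 (negPf r0).
- by move=> _ /esym /eqP; rewrite invr_eq0 (negPf r0').
- move=> cc _ hh; have {}cc : c = c' by lra.
  by case: _ / cc; case: _ / hh in h1' *; rewrite (bool_irrelevance h1 h1').
Qed.

Lemma aug_oreverse S : aug_coords (oreverse S) = - aug_coords S.
Proof.
case: S => [x r r0|h c h1] /=; rewrite ?aug_sphere ?aug_plane -[RHS]scaleN1r lvecZ.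
  by congr lvec; rewrite ?scalerA; [field|rewrite invrN mulN1r|rewrite invrN mulN1r].
by congr lvec; rewrite ?scaleN1r //; ring.
Qed.

(** * Incidence, interiors and tangency through the pairing *)

Lemma lor_sphere_opoint x r (r0 : r != 0) y :
  lor (aug_coords (OSphere x r0)) (opoint (Some y)) =
  (r ^+ 2 - sqnorm (y - x)) / (2 * r).
Proof.
by rewrite aug_sphere lor_lvec dotvZl sqnormB (dotvC x); field.
Qed.

Lemma lor_plane_opoint h c (h1 : sqnorm h == 1) y :
  lor (aug_coords (OPlane c h1)) (opoint (Some y)) = dotv h y - c.
Proof. by rewrite aug_plane lor_lvec; field. Qed.

Lemma ocarrierE S p : ocarrier S p <-> lor (aug_coords S) (opoint p) = 0.
Proof.
case: S p => [x r r0|h c h1] [y|]; rewrite [ocarrier _]/ocarrier /=.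
- rewrite lor_sphere_opoint; split=> [[_ [<-] ->]|/eqP].
    by rewrite subrr mul0r.
  rewrite mulf_eq0 invr_eq0 mulf_eq0 pnatr_eq0 (negPf r0) /= orbF subr_eq0.
  by move=> /eqP/esym e; exists y.
- rewrite aug_sphere lor_lvec dotv0; split=> [[]//|/eqP].
  by rewrite mulr0 mulr1 !add0r oppr_eq0 mulf_eq0 !invr_eq0 pnatr_eq0 (negPf r0).
- rewrite lor_plane_opoint; split=> [[//|[_ [<-] ->]]|/subr0_eq e].
    by rewrite subrr.
  by right; exists y.
- rewrite aug_plane lor_lvec dotv0 mulr0 mul0r addr0 mul0r subr0.
  by split=> // _; left.
Qed.

Lemma ointeriorE S y :
  ointerior S y <-> 0 < lor (aug_coords S) (opoint (Some y)).
Proof.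
case: S => [x r r0|h c h1] /=; last by rewrite lor_plane_opoint subr_gt0.
rewrite lor_sphere_opoint; case: ltP => [r_gt0|r_le0] /=.
  by rewrite pmulr_lgt0 ?invr_gt0 ?mulr_gt0 // subr_gt0.
have r_lt0 : r < 0 by rewrite lt_neqAle r0.
by rewrite nmulr_lgt0 ?invr_lt0 ?pmulr_rlt0 // subr_lt0.
Qed.

Lemma ointerior_nonempty S : (0 < n)%N -> exists y, ointerior S y.
Proof.
move=> n0; case: S => [x r r0|h c h1] /=; last first.
  by exists ((c + 1) *: h) => /=; rewrite dotvZr -/(sqnorm h) (eqP h1); lra.
case: ifP => _ /=.
  exists x; rewrite /= subrr; have /eqP -> : sqnorm (0 : 'rV[R]_n) == 0.
    by rewrite sqnorm_eq0.
  by rewrite exprn_even_gt0 //= r0.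
have e0 : (const_mx 1 : 'rV[R]_n) != 0.
  apply/eqP => /rowP /(_ (Ordinal n0)); rewrite !mxE => /eqP.
  by rewrite oner_eq0.
set e := const_mx 1 in e0; have := sqnorm_gt0 e0; set s := sqnorm e => s0.
(* With k s = r^2 + 1, the squared distance (k + 1)^2 s = (k + 2)(r^2 + 1) + s exceeds r^2 however
   small s is. *)
exists (x + ((r ^+ 2 + 1) / s + 1) *: e) => /=.
rewrite addrC addKr sqnormZ -/s.
set k := (r ^+ 2 + 1) / s.
have ks : k * s = r ^+ 2 + 1 by rewrite /k divfK // gt_eqF.
have k0 : 0 <= k by apply: divr_ge0 (ltW s0); rewrite addr_ge0 ?sqr_ge0.
have -> : (k + 1) ^+ 2 * s = (k + 2) * (k * s) + s by ring.
rewrite ks; have := sqr_ge0 r; set t := r ^+ 2; nra.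
Qed.

(* If the product is not [+-1], an antipode [q] of [p] projects to a vector
   orthogonal to both spheres but not to [p]; sliding it along [opoint p]
   makes it null, and this is a second common point. *)
Lemma tangent_lor S T p : tangent_at S T p ->
  lor (aug_coords S) (aug_coords T) ^+ 2 = 1.
Proof.
move=> tST; have [Sp Tp] : ocarrier S p /\ ocarrier T p.
  by have : [set p] p by []; rewrite -tST => -[].
have {}tST q : ocarrier S q -> ocarrier T q -> q = p.
  by move=> Sq Tq; have : (ocarrier S `&` ocarrier T) q by []; rewrite tST.
move: Sp Tp; rewrite !ocarrierE.
have := lor_aug S; have := lor_aug T.
move: (aug_coords S) (aug_coords T) (fun q => proj2 (ocarrierE S q))
  (fun q => proj2 (ocarrierE T q)) => w w' Sq Tq w'1 w1 wp w'p.
apply/eqP; apply: contraT; set t := lor w w' => t1.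
have d0 : 1 - t ^+ 2 != 0 by rewrite subr_eq0 eq_sym.
pose q : option 'rV[R]_n := if p is None then Some 0 else None.
have pq : lor (opoint q) (opoint p) != 0.
  by rewrite lor_opoint_eq0 /q; case: (p).
set P := opoint p in pq wp w'p; set Q := opoint q in pq.
(* Cramer's rule for the Gram matrix of [w] and [w'], whose determinant is 1 - t^2. *)
pose al := (lor w Q - t * lor w' Q) / (1 - t ^+ 2).
pose be := (lor w' Q - t * lor w Q) / (1 - t ^+ 2).
pose v := Q - al *: w - be *: w'.
have vP : lor v P = lor Q P.
  by rewrite /v !lorDl !lorNl !lorZl wp w'p !mulr0 !subr0.
have wv : lor w v = 0.
  rewrite /v !lorDr !lorNr !lorZr w1 -/t /al /be; field; exact: d0.
have w'v : lor w' v = 0.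
  rewrite /v !lorDr !lorNr !lorZr w'1 (lorC w' w) -/t /al /be; field; exact: d0.
clearbody v.
pose u := v - (lor v v / (2 * lor v P)) *: P.
have uP : lor u P = lor Q P.
  by rewrite /u lorDl lorNl lorZl vP lor_opointpp mulr0 subr0.
have uu : lor u u = 0.
  rewrite /u !lorDl !lorDr !lorNl !lorNr !lorZl !lorZr lor_opointpp (lorC P) vP.
  field; exact: pq.
have u0 : u != 0 by apply: contraNneq pq => u0; rewrite -uP u0 lorC lor0.
have [s [c c0 uE]] := null_opoint _ uu u0.
have sP : s = p.
  apply: tST; [apply: Sq|apply: Tq]; apply: (mulfI c0); rewrite mulr0 -lorZr -uE.
    by rewrite /u lorDr lorNr lorZr wv wp mulr0 subrr.
  by rewrite /u lorDr lorNr lorZr w'v w'p mulr0 subrr.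
by move: pq; rewrite -uP uE lorZl sP lor_opointpp mulr0 eqxx.
Qed.

(* The difference of the coordinates is null, so one interior contains the
   other. *)
Lemma lor1_ointerior_meet S T : (0 < n)%N ->
  lor (aug_coords S) (aug_coords T) = 1 -> ointerior S `&` ointerior T !=set0.
Proof.
move=> n0 ST; set w := aug_coords S in ST; set w' := aug_coords T in ST.
have [wE|w0] := eqVneq (w - w') 0.
  have [y Sy] := ointerior_nonempty S n0; exists y; split=> //.
  by rewrite -(aug_coords_inj _ _ (subr0_eq wE)).
have wN : lor (w - w') (w - w') = 0.
  by rewrite !lorDl !lorDr !lorNl !lorNr (lorC w') ST /w /w' !lor_aug; ring.
have [p [a a0 wE]] := null_opoint _ wN w0.
have lw y : lor w (opoint (Some y)) - lor w' (opoint (Some y)) =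
    a * lor (opoint p) (opoint (Some y)) by rewrite -lorZl -wE lorDl lorNl.
(* If a < 0, [w] pairs at least as high as [w'] with every point, so the interior of T lies in that
   of S; if a > 0, the roles are exchanged. *)
have [ap|an|ae] := ltgtP a 0; last by rewrite ae eqxx in a0.
- have [y Ty] := ointerior_nonempty T n0; exists y; split=> //.
  apply/ointeriorE; move/ointeriorE : Ty; rewrite -/w -/w'.
  by have := lw y; have := lor_opoint_le0 p (Some y); nra.
- have [y Sy] := ointerior_nonempty S n0; exists y; split=> //.
  apply/ointeriorE; move/ointeriorE : Sy; rewrite -/w -/w'.
  by have := lw y; have := lor_opoint_le0 p (Some y); nra.
Qed.

(** Product -1 makes the sum orthogonal to both unit vectors, so p lies on both spheres. Any common
    point is orthogonal to the sum, hence to [opoint p], hence equal to p. *)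
Lemma tangent_atE S T p a : lor (aug_coords S) (aug_coords T) = -1 ->
  a != 0 -> aug_coords S + aug_coords T = a *: opoint p ->
  forall q, tangent_at S T q <-> q = p.
Proof.
set w := aug_coords S; set w' := aug_coords T => ST a0 E.
have wE s : lor w (opoint s) + lor w' (opoint s) =
    a * lor (opoint p) (opoint s) by rewrite -lorDl E lorZl.
have wp : lor w (opoint p) = 0.
  by apply: (mulfI a0); rewrite mulr0 -lorZr -E lorDr ST lor_aug subrr.
have w'p : lor w' (opoint p) = 0.
  by apply: (mulfI a0); rewrite mulr0 -lorZr -E lorDr lorC ST lor_aug addNr.
have tp : tangent_at S T p.
  apply/seteqP; split=> [s [/ocarrierE Ss /ocarrierE Ts]|s ->].
    apply/esym/eqP; rewrite -lor_opoint_eq0; apply/eqP/(mulfI a0).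
    by rewrite mulr0 -wE /w /w' Ss Ts addr0.
  by split; apply/ocarrierE.
move=> q; split=> [|->//]; rewrite /tangent_at tp => e.
by have : [set q] q by []; rewrite -e.
Qed.

Lemma null_lor_lt0_same_sign p q a b :
  lor (a *: opoint p) (b *: opoint q) < 0 -> 0 < a -> 0 < b.
Proof.
rewrite lorZl lorZr => + a0; rewrite pmulr_rlt0 // => h.
by rewrite ltNge; apply: contraTN h => b0; rewrite -leNgt mulr_le0 ?lor_opoint_le0.
Qed.

(** At a common interior point both pairings would be positive, yet their sum is a times a
    nonpositive number. *)
Lemma ointerior_disjoint S T p a : 0 < a ->
  aug_coords S + aug_coords T = a *: opoint p ->
  ~ (ointerior S `&` ointerior T !=set0).
Proof.
move=> a0 E [y [/ointeriorE Sy /ointeriorE Ty]].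
have := addr_gt0 Sy Ty; rewrite -lorDl E lorZl pmulr_rgt0 // ltNge.
by rewrite lor_opoint_le0.
Qed.

End Lorentz.

(** * Descartes configurations and pairwise products *)

Section Descartes.
Context {R : realType} {n : nat}.
Hypothesis n_gt0 : (0 < n)%N.
Implicit Types S : {ffun 'I_(2 + n) -> osphere R n}.

(** Tangency leaves 1 or -1, and 1 would make interiors meet. Reversing both spheres keeps the
    product, so either disjointness alternative excludes 1. *)
Lemma descartes_lor S : descartes S -> forall i j, i != j ->
  lor (aug_coords (S i)) (aug_coords (S j)) = -1.
Proof.
move=> [tg _ dj] i j ij; have [p /tangent_lor /eqP] := tg i j ij.
rewrite sqrf_eq1 => /orP[/eqP e1|/eqP //]; move/eqP: ij => ij; exfalso; apply: ij.
case: dj => dj; apply: dj => //; apply: lor1_ointerior_meet => //.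
by rewrite !aug_oreverse lorNl lorNr opprK.
Qed.

(** Used to see that w_i + w_j does not vanish: its product with a third vector is -2. *)
Lemma exists_third (i j : 'I_(2 + n)) : exists2 k, k != i & k != j.
Proof.
have /subsetPn[k _] : ~~ (predT \subset pred2 i j).
  apply: contraTN n_gt0 => /subset_leq_card; rewrite cardT size_enum_ord card2.
  by rewrite -leqNgt; case: (i != j); rewrite ?addSn ?add0n ?ltnS // => /leq_trans ->.
by rewrite !inE negb_or => /andP[]; exists k.
Qed.

Lemma lor_descartes S :
  (forall i j, i != j -> lor (aug_coords (S i)) (aug_coords (S j)) = -1) ->
  descartes S.
Proof.
move=> H; pose w i := aug_coords (S i).
have lorw i j : lor (w i) (w j) = 2 * (i == j)%:R - 1.
  by have [->|ij] := eqVneq; rewrite /w ?lor_aug ?H //=; ring.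
have sum0 i j : w i + w j != 0.
  apply/eqP => e; have [k ki kj] := exists_third i j.
  have := lor0 (w k); rewrite -e lorDr !lorw (negPf ki) (negPf kj) /=; lra.
have sumE i j : i != j -> exists p, exists2 a, a != 0 & w i + w j = a *: opoint p.
  move=> ij; apply: null_opoint _ (sum0 i j).
  by rewrite lorDl !lorDr !lorw !eqxx (eq_sym j) (negPf ij) /=; ring.
(* Two pairs sharing exactly one index give the product 1 - 3 = -2, disjoint pairs give -4. *)
have neg i j k l : i != j -> k != l -> ((i = k /\ j = l) \/ (i = l /\ j = k)) \/
    lor (w i + w j) (w k + w l) < 0.
  rewrite lorDl !lorDr !lorw => ij kl.
  have [ik|ik] := eqVneq i k.
    subst k; rewrite (negPf kl) (eq_sym j) (negPf ij).
    by have [jl|jl] := eqVneq j l; [left; left|right => /=; lra].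
  have [il|il] := eqVneq i l.
    subst l; rewrite (eq_sym j i) (negPf ij).
    by have [jk|jk] := eqVneq j k; [left; right|right => /=; lra].
  right; have [jk|jk] := eqVneq j k; last by case: (_ == _) => /=; lra.
  by subst k; rewrite (negPf kl) /=; lra.
split.
- move=> i j ij; have [p [a a0 E]] := sumE i j ij; exists p.
  exact/(tangent_atE _ _ _ _ (H i j ij) a0 E).
- move=> i j k l p ij kl; have [p1 [a a0 E]] := sumE i j ij.
  have [p2 [b b0 F]] := sumE k l kl.
  move=> /(tangent_atE _ _ _ _ (H i j ij) a0 E) pE.
  move=> /(tangent_atE _ _ _ _ (H k l kl) b0 F) pF.
  case: (neg i j k l ij kl) => //.
  by rewrite E F -pE -pF lorZl lorZr lor_opointpp !mulr0 ltxx.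
(* If one sum is a positive multiple of a point vector, negative products make all of them so.
   Otherwise all are negative multiples, and reversing every sphere flips the sign. *)
have [[i0 [j0 [ij0 [p0 [a0 a0_gt0 E0]]]]]|noP] := pselect (exists i j, i != j /\
    exists p, exists2 a, 0 < a & w i + w j = a *: opoint p).
  left=> i j _ _ meet; apply/eqP; apply: contraT => ij; exfalso.
  have [p [a a_gt0 E]] : exists p, exists2 a, 0 < a & w i + w j = a *: opoint p.
    have [p [a _ E]] := sumE i j ij.
    case: (neg i0 j0 i j ij0 ij) => [[[<- <-]|[<- <-]]|].
    + by exists p0, a0.
    + by exists p0, a0; rewrite // addrC.
    by rewrite E0 E => /null_lor_lt0_same_sign /(_ a0_gt0) ?; exists p, a.
  exact: ointerior_disjoint _ _ _ _ a_gt0 E meet.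
right=> i j _ _ meet; apply/eqP; apply: contraT => ij; exfalso.
have [p [a a0 E]] := sumE i j ij; case: (ltgtP a 0) a0 => // [a_lt0|a_gt0] _.
  apply: (ointerior_disjoint _ _ p (- a) _ _ meet); rewrite ?oppr_gt0 //.
  by rewrite !aug_oreverse -opprD scaleNr -E.
by apply: noP; exists i, j; split=> //; exists p, a.
Qed.

End Descartes.

(** * The matrix equation as a condition on the Gram matrix *)

Section Gram.
Context {R : realType} {n : nat}.

Definition lor_mx : 'M[R]_(2 + n) :=
  block_mx (\matrix_(i < 2, j < 2) (if i == j then 0 else - 2^-1)) 0 0 1%:M.

Lemma lor_mxE (W : 'M[R]_(2 + n)) i j :
  (W *m lor_mx *m W^T) i j = lor (row i W) (row j W).
Proof.
rewrite -{1 2}[W]hsubmxK mul_row_block tr_row_mx mul_row_col !mulmx0 addr0 add0r.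
rewrite mulmx1 !mxE /lor dotvE addrC; congr (_ + _).
  by apply: eq_bigr => k _; rewrite !mxE.
rewrite /lfst /lsnd !mxE !big_ord_recl !big_ord0 !mxE !big_ord_recl !big_ord0 !mxE /=.
have -> : lift ord0 ord0 = 1 :> 'I_2 by apply: val_inj.
by rewrite /=; field.
Qed.

Lemma lor_mxK : lor_mx *m aug_form R n = 2%:M.
Proof.
rewrite mulmx_block !mulmx0 !mul0mx !addr0 !add0r mul1mx [RHS]scalar_mx_block.
congr block_mx; apply/matrixP => i j.
rewrite !mxE !big_ord_recl !big_ord0 !mxE.
by case: i j => [[|[|//]] i2] [[|[|//]] j2]; rewrite -!val_eqE /=; field.
Qed.

Definition gram_mx : 'M[R]_(2 + n) := 2%:M - const_mx 1.

(** With J the all-ones matrix, J^2 = (n + 2) J, and the coefficient of J in the product is -2/n - 1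
    + (n + 2)/n = 0. *)
Lemma gram_mxK : (0 < n)%N -> gram_mx *m descartes_form R n = 2%:M.
Proof.
move=> n0; have n0' : n%:R != 0 :> R by rewrite pnatr_eq0 -lt0n.
have JJ : const_mx 1 *m (const_mx 1 : 'cV[R]_(2 + n))^T = const_mx 1 :> 'M[R]_(2 + n).
  by apply/matrixP => i j; rewrite !mxE big_ord1 !mxE mulr1.
have J2 : (const_mx 1 : 'M[R]_(2 + n)) *m (const_mx 1 : 'M[R]_(2 + n)) =
    (2 + n)%:R *: const_mx 1.
  apply/matrixP => i j; rewrite !mxE mulr1 (eq_bigr (fun=> 1)).
    by rewrite sumr_const card_ord.
  by move=> k _; rewrite !mxE mulr1.
rewrite /descartes_form JJ /gram_mx mulmxBl mulmxBr mulmx1 mul_scalar_mx.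
rewrite mulmxBr mulmx1 -scalemxAr J2 !scalerA natrD -addrA -[RHS]addr0.
congr (_ + _); rewrite -opprD -[X in _ + (X - _)]scale1r -scalerBl -scalerDl.
by apply/eqP; rewrite oppr_eq0 scaler_eq0; apply/orP; left; apply/eqP; field.
Qed.

(** Up to the factor 2, [lor_mx] inverts [aug_form] and [gram_mx] inverts [descartes_form]. Either
    equation thus exhibits a one-sided inverse of W; for square matrices it is two-sided, and
    commuting the factors gives the other equation. *)
Lemma aug_formP (W : 'M[R]_(2 + n)) : (0 < n)%N ->
  W^T *m descartes_form R n *m W = aug_form R n <->
  W *m lor_mx *m W^T = gram_mx.
Proof.
move=> n0; have K := gram_mxK n0.
have n2 : 2%:R != 0 :> R by rewrite pnatr_eq0.
have half (A B : 'M[R]_(2 + n)) : A *m B = 2%:M -> B *m A = 2%:M.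
  move=> AB; have : (2^-1 *: A) *m B = 1%:M.
    by rewrite -scalemxAl AB scale_scalar_mx mulVf.
  move=> /mulmx1C; rewrite -scalemxAr => /(congr1 (fun M => 2 *: M)).
  by rewrite scalerA mulfV // scale1r scale_scalar_mx mulr1.
split=> E.
  have : lor_mx *m W^T *m descartes_form R n *m W = 2%:M.
    by rewrite -lor_mxK -E !mulmxA.
  move/half; rewrite !mulmxA => /(congr1 (mulmx^~ gram_mx)).
  rewrite -mulmxA (half _ _ K) mul_mx_scalar mul_scalar_mx.
  exact: scalerI.
have : W *m (lor_mx *m W^T *m descartes_form R n) = 2%:M.
  by rewrite !mulmxA E.
move/half; rewrite -!mulmxA => /(congr1 (mulmx (aug_form R n))).
rewrite mulmxA (half _ _ lor_mxK) mul_mx_scalar mul_scalar_mx mulmxA.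
exact: scalerI.
Qed.

End Gram.

Theorem theorem3p3 (R : realType) (n : nat) (hn : (2 <= n)%N) :
  (forall S : {ffun 'I_(2 + n) -> osphere R n}, descartes S ->
     (aug_mx S)^T *m descartes_form R n *m aug_mx S = aug_form R n) /\
  (forall W : 'M[R]_(2 + n),
     W^T *m descartes_form R n *m W = aug_form R n ->
     exists! S : {ffun 'I_(2 + n) -> osphere R n},
       descartes S /\ aug_mx S = W).
Proof.
have n0 : (0 < n)%N by apply: leq_trans hn.
split=> [S SD|W /(aug_formP _ n0) WG].
  apply/(aug_formP _ n0)/matrixP => i j; rewrite lor_mxE !rowK !mxE.
  have [->|ij] := eqVneq i j; first by rewrite lor_aug /=; ring.
  by rewrite (descartes_lor n0 _ SD) // sub0r.
have lorW i j : lor (row i W) (row j W) = 2 *+ (i == j) - 1.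
  by rewrite -lor_mxE WG !mxE.
(* Diagonal Gram entries 2 - 1 = 1 make each row a unit vector, hence the coordinates of a
   sphere. *)
have /choice [f fW] i : exists S, aug_coords S = row i W.
  by apply: aug_coords_onto; rewrite lorW eqxx /=; ring.
exists [ffun i => f i]; split=> [|S [_ SW]].
  split; last by apply/row_matrixP => i; rewrite rowK ffunE.
  apply: (lor_descartes n0) => i j ij.
  by rewrite !ffunE !fW lorW (negPf ij) sub0r.
apply/ffunP => i; rewrite ffunE; apply: aug_coords_inj.
by rewrite fW -SW rowK.
Qed.
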